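(* The mapping $\varphi \colon \mathcal{BM}^2_s \to \mathcal{BM}^3$ defined by \[ \varphi(C) = \operatorname{conv}\left((C \times \{0\}) \cup \{e^3\}\right) \quad \text{for } C \in \mathcal{BM}^2_s \] is an isometric embedding of $(\mathcal{BM}^2_s, d_{BM})$ into $(\mathcal{BM}^3, d_{BM})$, i.e. $d_{BM}(\varphi(C_1),\varphi(C_2)) = d_{BM}(C_1,C_2)$ for all $C_1, C_2 \in \mathcal{BM}^2_s$.
   Context: A convex body in $\mathbb{R}^n$ is a compact convex set with non-empty interior; it is $0$-symmetric if $-C = C$. For convex bodies $K, L \subseteq \mathbb{R}^n$, their Banach--Mazur distance is \[ d_{BM}(K,L) = \inf\{\rho \geq 0 : K+u \subseteq T(L+v) \subseteq \rho(K+u)\}, \] the infimum over all invertible linear operators $T: \mathbb{R}^n \to \mathbb{R}^n$ and vectors $u, v \in \mathbb{R}^n$. The Banach--Mazur compactum $\mathcal{BM}^n$ is the set of affine equivalence classes of convex bodies in $\mathbb{R}^n$, equipped with the multiplicative metric $d_{BM}$; $\mathcal{BM}^n_s$ is the subset of classes of $0$-symmetric convex bodies. In the formula for $\varphi$, a class in $\mathcal{BM}^2_s$ is represented by a $0$-symmetric convex body $C \subseteq \mathbb{R}^2$, and $\varphi(C)$ is the affine equivalence class of the indicated body. $e^3 = (0,0,1)$, and $\operatorname{conv}$ denotes the convex hull. *)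

(* Defs.v *)
From HB Require Import structures.
From mathcomp Require Import all_boot all_order all_algebra.
From mathcomp Require Import all_classical all_reals all_analysis.

Set Implicit Arguments.
Unset Strict Implicit.
Unset Printing Implicit Defensive.

Import Order.TTheory GRing.Theory Num.Theory.
Import numFieldNormedType.Exports.

Local Open Scope classical_set_scope.
Local Open Scope ring_scope.

Definition convex_body (R : realType) (n : nat) (K : set 'rV[R]_n) : Prop :=
  [/\ compact K, convex_set (M := 'rV[R]_n) K & interior K !=set0].

Definition zero_symmetric (R : realType) (n : nat) (C : set 'rV[R]_n) : Prop :=
  [set - x | x in C] = C.

Definition convex_hull (R : realType) (n : nat) (A : set 'rV[R]_n) :
    set 'rV[R]_n :=
  smallest (convex_set (M := 'rV[R]_n)) A.

Definition translate (R : realType) (n : nat) (K : set 'rV[R]_n)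
    (u : 'rV[R]_n) : set 'rV[R]_n :=
  [set x + u | x in K].

Definition dilate (R : realType) (n : nat) (rho : R) (K : set 'rV[R]_n) :
    set 'rV[R]_n :=
  [set rho *: x | x in K].

(* For convex bodies the set of admissible rho is nonempty and bounded below,
   so that the real-valued [inf] is its genuine infimum. *)
Definition BM_dist (R : realType) (n : nat) (K L : set 'rV[R]_n) : R :=
  inf [set rho : R | 0 <= rho /\
    exists (T : {linear 'rV[R]_n -> 'rV[R]_n}) (u v : 'rV[R]_n),
      [/\ bijective T,
          translate K u `<=` T @` translate L v
        & T @` translate L v `<=` dilate rho (translate K u)]].

Definition affine_class (R : realType) (n : nat) (K : set 'rV[R]_n) :
    set (set 'rV[R]_n) :=
  [set L | exists (T : {linear 'rV[R]_n -> 'rV[R]_n}) (u : 'rV[R]_n),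
     bijective T /\ L = translate (T @` K) u].

Definition BM (R : realType) (n : nat) : set (set (set 'rV[R]_n)) :=
  [set affine_class K | K in [set K : set 'rV[R]_n | convex_body K]].

Definition BMs (R : realType) (n : nat) : set (set (set 'rV[R]_n)) :=
  [set affine_class C |
    C in [set C : set 'rV[R]_n | convex_body C /\ zero_symmetric C]].

Arguments BM : clear implicits.
Arguments BMs : clear implicits.

(* The distance of two classes, computed on chosen representatives; the choice
   is irrelevant by [BM_class_distE] below. *)
Definition BM_class_dist (R : realType) (n : nat)
    (X Y : set (set 'rV[R]_n)) : R :=
  BM_dist (get X) (get Y).

(* [row_mx x 0] has type ['rV_(2 + 1)], which is convertible to ['rV_3]; the
   apex is e^3 = (0, 0, 1). *)
Definition pyramid (R : realType) (C : set 'rV[R]_2) : set 'rV[R]_3 :=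
  convex_hull ([set (row_mx x 0 : 'rV[R]_(2 + 1)) | x in C]
               `|` [set delta_mx 0 ord_max]).

Section Representatives.
Context (R : realType) (n : nat).
Implicit Types (K L : set 'rV[R]_n) (T : {linear 'rV[R]_n -> 'rV[R]_n}).

Lemma linear_inverse T : bijective T ->
  exists T' : {linear 'rV[R]_n -> 'rV[R]_n},
    [/\ bijective T', cancel T T' & cancel T' T].
Proof.
case=> g gK Kg.
pose glin := GRing.isLinear.Build R 'rV[R]_n 'rV[R]_n *:%R g
  (can2_linear gK Kg).
pose T' : {linear 'rV[R]_n -> 'rV[R]_n} := HB.pack g glin.
by exists T'; split=> //; exists T.
Qed.

Lemma translateD K u v : translate (translate K u) v = translate K (u + v).
Proof.
apply/seteqP; split=> [_ [_ [x Kx <-] <-]|_ [x Kx <-]].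
  by exists x; rewrite // addrA.
by exists (x + u); [exists x | rewrite addrA].
Qed.

Lemma translate0 K : translate K 0 = K.
Proof.
apply/seteqP; split=> [_ [x Kx <-]|x Kx]; first by rewrite addr0.
by exists x; rewrite ?addr0.
Qed.

Lemma image_translate T K u : T @` translate K u = translate (T @` K) (T u).
Proof.
apply/seteqP; split=> [_ [_ [x Kx <-] <-]|_ [_ [x Kx <-] <-]].
  by exists (T x); [exists x | rewrite linearD].
by exists (x + u); [exists x | rewrite linearD].
Qed.

Lemma image_dilate T (rho : R) K : T @` dilate rho K = dilate rho (T @` K).
Proof.
apply/seteqP; split=> [_ [_ [x Kx <-] <-]|_ [_ [x Kx <-] <-]].
  by exists (T x); [exists x | rewrite linearZ].
by exists (rho *: x); [exists x | rewrite linearZ].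
Qed.

Lemma affine_class_refl K : affine_class K K.
Proof.
exists (idfun : {linear 'rV[R]_n -> 'rV[R]_n}), 0; split.
  by exists idfun.
by rewrite image_id translate0.
Qed.

Lemma affine_class_sym K L : affine_class K L -> affine_class L K.
Proof.
move=> [T [u [/linear_inverse[T' [bT' TK _]] ->]]].
exists T', (- T' u); split=> //.
rewrite image_translate translateD subrr translate0 image_comp.
by rewrite (_ : T' \o T = idfun) ?image_id//; apply/funext.
Qed.

Lemma BM_dist_affine K K' L L' :
  affine_class K K' -> affine_class L L' -> BM_dist K' L' = BM_dist K L.
Proof.
suff wlog_sub K1 K2 L1 L2 : affine_class K1 K2 -> affine_class L1 L2 ->
    [set rho : R | 0 <= rho /\
      exists (T : {linear 'rV[R]_n -> 'rV[R]_n}) (u v : 'rV[R]_n),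
        [/\ bijective T, translate K1 u `<=` T @` translate L1 v
          & T @` translate L1 v `<=` dilate rho (translate K1 u)]] `<=`
    [set rho : R | 0 <= rho /\
      exists (T : {linear 'rV[R]_n -> 'rV[R]_n}) (u v : 'rV[R]_n),
        [/\ bijective T, translate K2 u `<=` T @` translate L2 v
          & T @` translate L2 v `<=` dilate rho (translate K2 u)]].
  move=> KK' LL'; congr inf; apply/seteqP; split; last exact: wlog_sub.
  by apply: wlog_sub; exact: affine_class_sym.
move=> [A [a [bA ->]]] [B [b [bB ->]]] rho [rho0 [T [u [v [bT KL LK]]]]].
have [B' [bB' BK B'K]] := linear_inverse bB.
split=> //; exists (A \o T \o B'), (A u - a), (B v - b).
have EK : translate (translate (A @` K1) a) (A u - a) = A @` translate K1 u.
  by rewrite translateD addrC subrK image_translate.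
have EL : (A \o T \o B') @` translate (translate (B @` L1) b) (B v - b) =
    A @` (T @` translate L1 v).
  rewrite translateD addrC subrK -image_translate !image_comp.
  by congr (_ @` _); apply/funext => x /=; rewrite BK.
split; first exact: bij_comp (bij_comp bA bT) bB'.
- by rewrite EK EL; exact: image_subset.
- by rewrite EK EL -image_dilate; exact: image_subset.
Qed.

Lemma BM_class_distE K L :
  BM_class_dist (affine_class K) (affine_class L) = BM_dist K L.
Proof.
apply: BM_dist_affine; apply: (@getI _ _ _ (affine_class_refl _)).
Qed.

End Representatives.

(* Main.v *)
(** The heart of the matter is that a pair of inclusions [P1 <= S <= rho P1 + c]
between (affine images of) pyramids over [C1] and [C2], with [rho < 2], yields
[C1 <= S' C2 <= rho C1] for a linear map [S'] of the plane; together with the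
bound [d (C1, C2) <= 2], which comes from Auerbach bases, this gives one
inequality, and the other one is obtained by extending planar maps by the
identity on the axis.

Let [F] and [G] be the affine maps realizing [P1 -> P2] and [P2 -> rho P1 + c].
If, measured by the height over the base of [P1], the apex of [S] is a highest
point of [S], then [S'] sends the base of [S] into the base plane of [P1] by
projecting along the axis of [S] (so [S'] is the inverse of the linear part of
[F] restricted to the base): tilting the base of [S] moves its center up, where
[rho P1 + c] is thinner, and this compensates for the distortion as soon as
[rho <= 2]. If some base point of [S] is higher than the apex, then the center
of that base lies, above the base of [rho P1 + c], at least half as high as the
apex of [P1]; comparing chords parallel to both base planes, the chord of [C1]
through its center in this direction would be at most [rho - 1 < 1] times
itself. *)

Require Import Defs.
From HB Require Import structures.
From mathcomp Require Import all_boot all_order all_algebra.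
From mathcomp Require Import all_classical all_reals all_analysis.
From mathcomp Require Import ring lra.

Set Implicit Arguments.
Unset Strict Implicit.
Unset Printing Implicit Defensive.

Import Order.TTheory GRing.Theory Num.Theory.
Import numFieldNormedType.Exports.

Local Open Scope classical_set_scope.
Local Open Scope ring_scope.

(** * Convexity and the gauge of a symmetric convex set *)

Lemma convex_setP (R : realType) (n : nat) (A : set 'rV[R]_n) :
  convex_set (M := 'rV[R]_n) A <->
  (forall x y (s t : R), 0 <= s -> 0 <= t -> s + t = 1 -> A x -> A y ->
     A (s *: x + t *: y)).
Proof.
split=> [cA x y s t s0 t0 st Ax Ay|cA x y l].
  have s1 : s <= 1 by lra.
  have := cA x y (Itv01 s0 s1) (mem_set Ax) (mem_set Ay).
  rewrite inE; congr (A _).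
  by rewrite /conv/= /unstable.onem/= -st; congr (_ + _ *: _); ring.
rewrite !inE => Ax Ay; apply: cA => //.
- by rewrite subr_ge0.
- by rewrite /unstable.onem addrC subrK.
Qed.

(* For [C] convex, symmetric and absorbing, [scaled C l x] reads
   [`|x|_C <= l], where [`| . |_C] is the norm with unit ball [C]. *)
Definition scaled (R : realType) (n : nat) (C : set 'rV[R]_n) (l : R)
    (x : 'rV[R]_n) : Prop :=
  0 <= l /\ dilate l C x.

Section Scaled.
Context (R : realType) (n : nat) (C : set 'rV[R]_n).
Hypotheses (convC : convex_set (M := 'rV[R]_n) C) (symC : zero_symmetric C)
  (C0 : C 0).

Lemma scaled1 x : C x -> scaled C 1 x.
Proof. by move=> Cx; split=> //; exists x; rewrite ?scale1r. Qed.

Lemma scaled_le1 l x : scaled C l x -> l <= 1 -> C x.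
Proof.
move=> [l0 [y Cy <-]] l1.
rewrite -[_ *: _]addr0 -(scaler0 _ (1 - l)).
by apply: ((convex_setP C).1 convC) => //; lra.
Qed.

Lemma scaled_le l m x : scaled C l x -> l <= m -> scaled C m x.
Proof.
move=> [l0 [y Cy <-]] lm; have m0 : 0 <= m by lra.
split=> //; have [mE|mn0] := eqVneq m 0.
  by exists 0; rewrite // mE scale0r (_ : l = 0) ?scale0r//; lra.
have mp : 0 < m by rewrite lt_def mn0.
exists ((l / m) *: y); last by rewrite scalerA mulrC divfK.
apply: (@scaled_le1 (l / m)); last by rewrite ler_pdivrMr ?mul1r.
by split; [rewrite divr_ge0|exists y].
Qed.

Lemma scaledN l x : scaled C l x -> scaled C l (- x).
Proof.
move=> [l0 [y Cy <-]]; split=> //; exists (- y); last by rewrite scalerN.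
by rewrite -symC; exists y.
Qed.

Lemma scaledD l m x y : scaled C l x -> scaled C m y -> scaled C (l + m) (x + y).
Proof.
move=> [l0 [x' Cx <-]] [m0 [y' Cy <-]]; split; first exact: addr_ge0.
have [lm0|lmn0] := eqVneq (l + m) 0.
  have lE : l = 0 by lra.
  have mE : m = 0 by lra.
  by exists 0 => //; rewrite lE mE !scale0r scaler0 addr0.
exists ((l / (l + m)) *: x' + (m / (l + m)) *: y').
  apply: ((convex_setP C).1 convC) => //; rewrite ?divr_ge0 ?addr_ge0//.
  by rewrite -mulrDl divff.
by rewrite scalerDr !scalerA !(mulrC (l + m)) !divfK.
Qed.

Lemma scaledZ k l x : scaled C l x -> scaled C (`|k| * l) (k *: x).
Proof.
suff pos h : 0 <= h -> scaled C l x -> scaled C (h * l) (h *: x).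
  have [k0 Cx|k0 Cx] := ger0P k; first exact: pos.
  by rewrite -[k in k *: x]opprK scaleNr; apply/scaledN/pos => //; lra.
move=> h0 [l0 [y Cy <-]]; split; first exact: mulr_ge0.
by exists y; rewrite ?scalerA.
Qed.

Lemma scaledB l m x y : scaled C l x -> scaled C m y -> scaled C (l + m) (x - y).
Proof. by move=> Cx Cy; apply: scaledD => //; exact: scaledN. Qed.

End Scaled.

(** * Symmetric convex bodies *)

Section Body.
Context (R : realType) (n : nat) (C : set 'rV[R]_n).
Hypotheses (bodyC : convex_body C) (symC : zero_symmetric C).

Lemma body_opp x : C x -> C (- x).
Proof. by move=> Cx; rewrite -symC; exists x. Qed.

(** Symmetry moves an interior ball to the origin: [x] is the midpoint of [x0 + 2 *: x], which lies
    in the ball around [x0], and of [- x0]. *)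
Lemma body_ball0 : exists2 r : R, 0 < r & forall x, `|x| < r -> C x.
Proof.
have [_ /convex_setP cC [x0]] := bodyC.
rewrite /interior/= => /nbhs_ballP[e /= e0 ballC].
exists (e / 2); first by rewrite divr_gt0.
move=> x xe.
have -> : x = 2^-1 *: (x0 + 2 *: x) + 2^-1 *: (- x0).
  by rewrite -scalerDr addrAC subrr add0r scalerA mulVf ?scale1r.
apply: cC => //; try lra.
  apply: ballC; rewrite -ball_normE /= opprD addrA subrr add0r normrN normrZ.
  by rewrite (ger0_norm (ler0n _ _)); lra.
apply/body_opp/ballC; exact: ballxx.
Qed.

Lemma body0 : C 0.
Proof. by have [r r0] := body_ball0; apply; rewrite normr0. Qed.

Lemma body_absorbing x : exists2 t : R, 0 < t & C (t *: x).
Proof.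
have [r r0 rC] := body_ball0.
have [->|x0] := eqVneq x 0; first by exists 1; rewrite // scaler0; exact: body0.
have nx : 0 < `|x| by rewrite normr_gt0.
exists (r / 2 / `|x|); first by rewrite !divr_gt0.
apply: rC; rewrite normrZ ger0_norm ?divr_ge0 ?(ltW nx)//; last lra.
by rewrite divfK ?gt_eqF//; lra.
Qed.

Lemma body_line_bounded x : x != 0 -> has_ubound [set t : R | C (t *: x)].
Proof.
move=> x0; have [/compact_bounded/ex_strict_bound_gt0[M M0 CM] _ _] := bodyC.
have nx : 0 < `|x| by rewrite normr_gt0.
exists (M / `|x|) => t /= /CM /ltW; rewrite normrZ ler_pdivlMr// => h.
by apply: le_trans h; rewrite ler_wpM2r ?ler_norm ?(ltW nx).
Qed.

(** Shrinking would put [(t / k) *: x] in [C] whenever [t *: x] is, so the finite positive number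
    [sup S] would be at most [k * sup S]. *)
Lemma body_not_shrinking (k : R) x : x != 0 -> k < 1 ->
  ~ (forall t, C (t *: x) -> scaled C k (t *: x)).
Proof.
move=> x0 k1 shr.
set S := [set t : R | C (t *: x)].
have [t0 t00 St0] := body_absorbing x.
have ubS : has_ubound S := body_line_bounded x0.
have hS : has_sup S by split=> //; exists t0.
have kn0 : 0 < k.
  have [k0 [y Cy]] := shr t0 St0.
  rewrite lt_def k0 andbT; case: eqP => // ->; rewrite scale0r => /esym/eqP.
  by rewrite scaler_eq0 (negPf x0) gt_eqF.
have St t : S t -> t / k <= sup S.
  move=> /shr[_ [y Cy yE]]; apply: ub_le_sup => //.
  by rewrite /S/= mulrC -scalerA -yE scalerA mulVf ?scale1r// gt_eqF.
have s0 : 0 < sup S by apply: lt_le_trans (St _ St0); rewrite divr_gt0.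
have : sup S <= k * sup S.
  apply: ge_sup; first by exists t0.
  by move=> t /St; rewrite ler_pdivrMr// mulrC.
by nra.
Qed.

End Body.

(* The pyramid over the base [rho C] with apex [(0, rho)], as a set of pairs
   (base component, height). *)
Definition cone_at (R : realType) (n : nat) (rho : R) (C : set 'rV[R]_n)
    (x : 'rV[R]_n) (t : R) : Prop :=
  0 <= t /\ scaled C (rho - t) x.

(** Forms are encoded as columns so that they can be blocks of the matrix of a map of 3-space. *)
Definition lform (R : realType) (n : nat) (f : 'cV[R]_n) (x : 'rV[R]_n) : R :=
  (x *m f) 0 0.

Section Form.
Context (R : realType) (n : nat) (f : 'cV[R]_n).
Implicit Types x y : 'rV[R]_n.

Lemma lform0 : lform f 0 = 0.
Proof. by rewrite /lform mul0mx mxE. Qed.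

Lemma lformD x y : lform f (x + y) = lform f x + lform f y.
Proof. by rewrite /lform mulmxDl mxE. Qed.

Lemma lformZ k x : lform f (k *: x) = k * lform f x.
Proof. by rewrite /lform -scalemxAl mxE. Qed.

Lemma lformN x : lform f (- x) = - lform f x.
Proof. by rewrite /lform mulNmx mxE. Qed.

Lemma lform_mulmx (A : 'M[R]_n) x : lform f (x *m A) = lform (A *m f) x.
Proof. by rewrite /lform mulmxA. Qed.

Lemma lform_scale k x : lform (k *: f) x = k * lform f x.
Proof. by rewrite /lform -scalemxAr mxE. Qed.

End Form.

Lemma lform_ker (R : realType) (f : 'cV[R]_2) : exists2 z, z != 0 & lform f z = 0.
Proof.
pose w (a b : R) : 'rV[R]_2 := \row_j (if j == 0 then a else b).
have wE a b : lform f (w a b) = a * f 0 0 + b * f 1 0.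
  rewrite /lform mxE big_ord_recl big_ord1 !mxE /=.
  by congr (_ * f _ _ + _ * f _ _); exact: val_inj.
have nz a b : w a b = 0 -> a = 0 /\ b = 0.
  by move=> /rowP w0; have := (w0 0, w0 1); rewrite !mxE /= => -[-> ->].
have [/nz[f1 f0]|/eqP h] := eqVneq (w (f 1 0) (- f 0 0)) 0.
  exists (w 1 0); last by rewrite wE; lra.
  by apply/eqP => /nz[/eqP]; rewrite oner_eq0.
by exists (w (f 1 0) (- f 0 0)); [exact/eqP|rewrite wE; ring].
Qed.

(** Admissibility of [rho] for the distance, without translations; between symmetric bodies
    translations can always be removed ([centered_inner], [centered_outer]). *)
Definition sandwich (R : realType) (n : nat) (C1 C2 : set 'rV[R]_n) (rho : R) :=
  exists T : {linear 'rV[R]_n -> 'rV[R]_n},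
    [/\ bijective T, C1 `<=` T @` C2 & T @` C2 `<=` dilate rho C1].

(** * From nested pyramids to nested bases, for [rho < 2] *)

Section Core.
Context (R : realType) (C1 C2 : set 'rV[R]_2).
Hypotheses (body1 : convex_body C1) (sym1 : zero_symmetric C1).
Hypotheses (body2 : convex_body C2) (sym2 : zero_symmetric C2).
(* [F (x, t) = (x A + t p + q, f x + t d + al)] and
   [G (z, s) = (z A' + s p' + q', f' z + s d' + be)] have mutually inverse linear
   parts, so [G \o F] is a translation; [c3] is its vertical component. *)
Context (A A' : 'M[R]_2) (f f' : 'cV[R]_2) (p p' q q' : 'rV[R]_2)
  (d d' al be rho : R).
Hypothesis rho2 : rho < 2.
Hypothesis F_cone : forall x t, cone_at 1 C1 x t ->
  cone_at 1 C2 (x *m A + t *: p + q) (lform f x + t * d + al).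
Hypothesis G_cone : forall z s, cone_at 1 C2 z s ->
  cone_at rho C1 (z *m A' + s *: p' + q') (lform f' z + s * d' + be).
Hypothesis inv_base : A *m A' + f *m p' = 1%:M.
Hypothesis inv_form : A *m f' + d' *: f = 0.
Hypothesis inv_apex : lform f' p + d * d' = 1.
Hypothesis inv_base' : A' *m A + f' *m p = 1%:M.
Hypothesis inv_form' : A' *m f + d *: f' = 0.

Let cv1 := let: And3 _ c _ := body1 in c.
Let cv2 := let: And3 _ c _ := body2 in c.
Let zero1 : C1 0 := body0 body1 sym1.
Let zero2 : C2 0 := body0 body2 sym2.

Let c3 := lform f' q + al * d' + be.

Lemma F_base x : C1 x ->
  0 <= lform f x + al /\ scaled C2 (1 - (lform f x + al)) (x *m A + q).
Proof.
move=> Cx; have /F_cone : cone_at 1 C1 x 0.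
  by split=> //; rewrite subr0; exact: scaled1.
by rewrite scale0r addr0 mul0r addr0 => -[].
Qed.

Lemma F_apex : 0 <= d + al /\ scaled C2 (1 - (d + al)) (p + q).
Proof.
have /F_cone : cone_at 1 C1 0 1.
  by split=> //; rewrite subrr; split=> //; exists 0; rewrite ?scaler0.
by rewrite mul0mx lform0 !add0r scale1r mul1r => -[].
Qed.

Lemma G_base z : C2 z ->
  0 <= lform f' z + be /\ scaled C1 (rho - (lform f' z + be)) (z *m A' + q').
Proof.
move=> Cx; have /G_cone : cone_at 1 C2 z 0.
  by split=> //; rewrite subr0; exact: scaled1.
by rewrite scale0r addr0 mul0r addr0 => -[].
Qed.

Lemma G_apex : 0 <= d' + be /\ scaled C1 (rho - (d' + be)) (p' + q').
Proof.
have /G_cone : cone_at 1 C2 0 1.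
  by split=> //; rewrite subrr; split=> //; exists 0; rewrite ?scaler0.
by rewrite mul0mx lform0 !add0r scale1r mul1r => -[].
Qed.

Lemma al_ge0 : 0 <= al.
Proof. by have [] := F_base zero1; rewrite lform0 add0r. Qed.

Lemma q_scaled : scaled C2 (1 - al) q.
Proof. by have [_] := F_base zero1; rewrite lform0 mul0mx !add0r. Qed.

(** [c3] is the height of the image under [G \o F] of the center of the first base. *)
Lemma c3_ge0 : 0 <= c3.
Proof.
have [h qC] := F_base zero1.
have /G_cone : cone_at 1 C2 q al by split; [exact: al_ge0|exact: q_scaled].
by case.
Qed.

(** The right-hand side is the height of the image under [G \o F] of the first apex, which the
    translation lifts from 1 to [c3 + 1]. *)
Lemma c3_apex : c3 + 1 = lform f' (p + q) + (d + al) * d' + be.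
Proof. by rewrite /c3 lformD -inv_apex; ring. Qed.

Lemma c3_le : c3 + 1 <= rho.
Proof.
have [h pqC] := F_apex.
have /G_cone : cone_at 1 C2 (p + q) (d + al) by [].
by rewrite -c3_apex => -[_ []]; lra.
Qed.

Lemma base_le_apex :
  (forall z, C2 z -> lform f' z <= d') -> sandwich C1 C2 rho.
Proof.
move=> hmax.
have fz_ge z : C2 z -> - lform f' z <= d'.
  by move=> /(body_opp sym2)/hmax; rewrite lformN.
have d'0 : 0 <= d' by have := hmax _ zero2; rewrite lform0.
have scaled_form l z : scaled C2 l z -> lform f' z <= l * d'.
  by move=> [l0 [y Cy <-]]; rewrite lformZ ler_wpM2l// hmax.
(* The translated apex of the first pyramid lies in the image of the second, whose highest point is
   its apex. *)
have c3_top : c3 + 1 <= d' + be.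
  have [h [h1 pqC]] := F_apex.
  by have := scaled_form _ _ F_apex.2; rewrite c3_apex; lra.
(* With [d' = 0] no point of the image of the second pyramid would be higher or lower than [be], yet
   it has points at heights [c3] and [c3 + 1]. *)
have d'n0 : d' != 0.
  apply/eqP => d'E.
  have := scaled_form _ _ (scaledN sym2 q_scaled).
  have := c3_top; rewrite /c3 lformN d'E; lra.
have d'p : 0 < d' by rewrite lt_def d'n0.
(* the projection along the axis of the second pyramid *)
pose S := A' - d'^-1 *: (f' *m p').
have AS : A *m S = 1%:M.
  rewrite mulmxBr -scalemxAr mulmxA.
  move: inv_form => /eqP; rewrite addr_eq0 => /eqP ->.
  by rewrite mulNmx -scalemxAl scalerN opprK scalerA mulVf// scale1r.
have SA : S *m A = 1%:M by exact: mulmx1C.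
exists (mulmxr S); split.
- by exists (mulmxr A) => x /=; rewrite -mulmxA ?AS ?SA mulmx1.
- move=> x Cx; exists (x *m A); last by rewrite /= -mulmxA AS mulmx1.
  (* In half the difference of the images of [x] and [- x] the tilts [lform f x] cancel, leaving
     gauge at most [1 - al]. *)
  have [_ h1] := F_base Cx; have [_ h2] := F_base (body_opp sym1 Cx).
  have h3 := scaledZ sym2 2^-1 (scaledB cv2 sym2 zero2 h1 h2).
  have := scaled_le1 cv2 zero2 h3.
  rewrite lformN ger0_norm ?invr_ge0//.
  rewrite (_ : 2^-1 *: _ = x *m A); last first.
    by apply/rowP => i; rewrite mulNmx !mxE; field.
  by apply; have := al_ge0; lra.
- move=> _ [z Cz <-] /=.
  set t := lform f' z / d'.
  have tE : lform f' z = t * d' by rewrite divfK.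
  have zS : z *m S = (z *m A' + t *: q') - t *: (p' + q').
    rewrite mulmxBr scalerDr opprD addrACA subrr addr0; congr (_ - _).
    rewrite -scalemxAr mulmxA (mx11_scalar (z *m f')) mul_scalar_mx scalerA.
    by rewrite mulrC.
  have t1 : t <= 1 by rewrite ler_pdivrMr// mul1r hmax.
  have t1' : -1 <= t by rewrite ler_pdivlMr// mulN1r lerNl fz_ge.
  have [b1 g1] := G_base Cz; have [b2 g2] := G_base (body_opp sym2 Cz).
  have [b3 g3] := G_apex.
  (* weights [(1 + t) / 2] and [(1 - t) / 2]: bounds [z A' + t q'] by
     [rho - be - t ^ 2 d'] *)
  have {}g1 := scaledZ sym1 ((1 + t) / 2) g1.
  have {}g2 := scaledZ sym1 ((1 - t) / 2) g2.
  have {}g3 := scaledZ sym1 t g3.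
  have := scaledB cv1 sym1 zero1 (scaledB cv1 sym1 zero1 g1 g2) g3.
  rewrite [X in scaled _ _ (X - _)](_ : _ = z *m A' + t *: q'); last first.
    by rewrite mulNmx; apply/rowP => i; rewrite !mxE; field.
  rewrite -zS => h; suff: scaled C1 rho (z *m S) by case.
  apply: scaled_le h _ => //.
  rewrite ger0_norm; last lra.
  rewrite ger0_norm; last lra.
  rewrite lformN tE in b1 b2 *.
  (* What remains is [|t| (rho - (d' + be)) <= be + t ^ 2 d']. By [E2] the left side is at most
     [|t| (d' + be)], and the right side exceeds this by [(1 - |t|) (be - |t| d')], which is
     nonnegative by the base heights [b1] and [b2]. *)
  have E1 : 1 <= d' + be by apply: le_trans c3_top; rewrite lerDr c3_ge0.
  have E2 : rho - (d' + be) <= d' + be by have := rho2; lra.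
  have [tp|tn] := ger0P t; nra.
Qed.

Lemma base_higher z : C2 z -> d' < lform f' z -> False.
Proof.
move=> Cz hz.
have be2 : c3 + 1 <= 2 * be.
  (* The height [c3 + 1] of the translated apex is a weighted mean of the heights of a base point
     and of the second apex, and the latter is below [z]; so some base point [y] is at least as
     high. That [- y] has nonnegative height then gives [lform f' y <= be]. *)
  have [y Cy hy] : exists2 y, C2 y & c3 + 1 <= lform f' y + be.
    have [h [h1 [y Cy yE]]] := F_apex.
    have := c3_apex; rewrite -yE lformZ => cE.
    have [yz|zy] := leP (lform f' y) (lform f' z); [exists z|exists y] => //.
      by rewrite cE; nra.
    by rewrite cE; nra.
  by have [] := G_base (body_opp sym2 Cy); rewrite lformN; lra.
(* the direction common to the two base planes *)
have [z0 z00 fz0] := lform_ker f'.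
set v0 := z0 *m A'.
have v0A : v0 *m A = z0.
  rewrite -mulmxA.
  move: inv_base' => /eqP; rewrite eq_sym -subr_eq => /eqP <-.
  rewrite mulmxBr mulmx1 mulmxA (mx11_scalar (z0 *m f')).
  by rewrite -/(lform f' z0) fz0 mul_scalar_mx scale0r subr0.
have fv0 : lform f v0 = 0.
  rewrite lform_mulmx.
  move: inv_form' => /eqP; rewrite addr_eq0 => /eqP ->.
  by rewrite -scaleNr lform_scale fz0 mulr0.
have v00 : v0 != 0.
  by apply: contraNneq z00 => v0E; rewrite -v0A v0E mul0mx.
apply: (@body_not_shrinking _ _ _ body1 sym1 (rho - 1) v0 v00).
  by have := rho2; lra.
move=> k Cv.
have := F_base Cv.
have := F_base (body_opp sym1 Cv).
rewrite !mulNmx lformN -scalemxAl v0A lformZ fv0 mulr0 oppr0 add0r.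
move=> [a0 [a1 [y2 Cy2 y2E]]] [_ [_ [y1 Cy1 y1E]]].
(* Reflecting [y1] and [y2] makes [lform f' q] enter the gauge bound with a plus sign, and [be2] and
   [c3_le] bound it from above. *)
have [_ g1] := G_base (body_opp sym2 Cy1).
have [_ g2] := G_base (body_opp sym2 Cy2).
have h := scaledZ sym1 ((1 - al) / 2) (scaledB cv1 sym1 zero1 g2 g1).
have fq1 : (1 - al) * lform f' y1 = lform f' q.
  by rewrite -lformZ y1E lformD lformZ fz0 mulr0 add0r.
have fq2 : (1 - al) * lform f' y2 = lform f' q.
  by rewrite -lformZ y2E lformD lformN lformZ fz0 mulr0 oppr0 add0r.
(* [G] sends [- y1] and [- y2] to two points of the same height whose difference
   is parallel to [v0] *)
have vE : ((1 - al) / 2) *: ((- y2 *m A' + q') - (- y1 *m A' + q')) = k *: v0.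
  rewrite !mulNmx.
  transitivity (2^-1 *: (((1 - al) *: y1) *m A' - ((1 - al) *: y2) *m A')).
    by rewrite -!scalemxAl; apply/rowP => i; rewrite !mxE; field.
  rewrite y1E y2E -mulmxBl (_ : _ - _ = (2 * k) *: z0); last first.
    by apply/rowP => i; rewrite !mxE; ring.
  by rewrite -scalemxAl scalerA mulrA mulVf// mul1r.
rewrite vE ger0_norm in h; last lra.
apply: scaled_le h _ => //.
rewrite !lformN.
have -> : (1 - al) / 2 * (rho - (- lform f' y2 + be) + (rho - (- lform f' y1 + be)))
  = (1 - al) * (rho - be) + lform f' q.
  have -> : lform f' q = ((1 - al) * lform f' y1 + (1 - al) * lform f' y2) / 2.
    by rewrite fq1 fq2; field.
  by field.
(* If [0 <= rho - be + d'], the bound [rho - 1] follows from [be2]; otherwise [0 <= d' + be] forces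
   [rho < 2 * be] and [c3_le] suffices. *)
have [b3 _] := G_apex.
have := c3_ge0; have := c3_le; move: be2; rewrite /c3.
set Q := lform f' q; nra.
Qed.

Lemma cone_sandwich_base : sandwich C1 C2 rho.
Proof.
have [|/existsNP[z /not_implyP[Cz /negP]]] :=
  pselect (forall z, C2 z -> lform f' z <= d'); first exact: base_le_apex.
by rewrite -ltNge => /(base_higher Cz).
Qed.

End Core.

(** * Base and height coordinates; the pyramid as a cone *)

Definition pt (R : realType) (x : 'rV[R]_2) (t : R) : 'rV[R]_3 :=
  row_mx x t%:M : 'rV[R]_(2 + 1).

Definition pbase (R : realType) (y : 'rV[R]_3) : 'rV[R]_2 :=
  lsubmx (y : 'rV[R]_(2 + 1)).

Definition pheight (R : realType) (y : 'rV[R]_3) : R :=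
  rsubmx (y : 'rV[R]_(2 + 1)) 0 0.

Section Points.
Context (R : realType).
Implicit Types (x : 'rV[R]_2) (y : 'rV[R]_3) (s t : R).

Lemma ptK y : pt (pbase y) (pheight y) = y.
Proof. by rewrite /pt -mx11_scalar hsubmxK. Qed.

Lemma pbaseK x t : pbase (pt x t) = x.
Proof. exact: row_mxKl. Qed.

Lemma pheightK x t : pheight (pt x t) = t.
Proof. by rewrite /pheight row_mxKr mxE. Qed.

Lemma pbaseD y1 y2 : pbase (y1 + y2) = pbase y1 + pbase y2.
Proof. exact: linearD. Qed.

Lemma pbaseZ k y : pbase (k *: y) = k *: pbase y.
Proof. exact: linearZ. Qed.

Lemma pheightD y1 y2 : pheight (y1 + y2) = pheight y1 + pheight y2.
Proof. by rewrite /pheight !mxE. Qed.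

Lemma pheightZ k y : pheight (k *: y) = k * pheight y.
Proof. by rewrite /pheight !mxE. Qed.

Lemma ptD x1 x2 t1 t2 : pt (x1 + x2) (t1 + t2) = pt x1 t1 + pt x2 t2.
Proof. by rewrite -[RHS]ptK pbaseD pheightD !pbaseK !pheightK. Qed.

Lemma ptZ k x t : pt (k *: x) (k * t) = k *: pt x t.
Proof. by rewrite -[RHS]ptK pbaseZ pheightZ pbaseK pheightK. Qed.

Lemma pt_base x : pt x 0 = row_mx x 0 :> 'rV[R]_(2 + 1).
Proof. by rewrite /pt raddf0. Qed.

Lemma pt_apex : pt 0 1 = delta_mx 0 ord_max :> 'rV[R]_3.
Proof.
rewrite -[RHS]ptK; congr pt.
  by apply/rowP => i; rewrite !mxE; case: i => [[|[|]]].
by rewrite /pheight !mxE.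
Qed.

End Points.

Section Pyramid.
Context (R : realType) (C : set 'rV[R]_2).
Hypotheses (convC : convex_set (M := 'rV[R]_2) C) (C0 : C 0).

(** The cone is convex and contains the base and the apex; conversely, its point at height [t] mixes
    a base point and the apex with weights [1 - t] and [t]. *)
Lemma pyramidP y : pyramid C y <-> cone_at 1 C (pbase y) (pheight y).
Proof.
split.
  apply: (@smallest_sub _ _ _ [set y | cone_at 1 C (pbase y) (pheight y)]).
    apply/convex_setP => y1 y2 s t s0 t0 st [h1 C1] [h2 C2].
    rewrite /mkset pbaseD !pbaseZ pheightD !pheightZ; split.
      by rewrite addr_ge0 ?mulr_ge0.
    have -> : 1 - (s * pheight y1 + t * pheight y2) =
      s * (1 - pheight y1) + t * (1 - pheight y2) by rewrite -[X in X - _]st; ring.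
    apply: scaledD => //.
      move: C1 => [l0 [x Cx <-]]; split; first exact: mulr_ge0.
      by exists x; rewrite ?scalerA.
    move: C2 => [l0 [x Cx <-]]; split; first exact: mulr_ge0.
    by exists x; rewrite ?scalerA.
  move=> _ [[x Cx <-]|->]; rewrite /mkset.
    by rewrite -pt_base pbaseK pheightK; split; rewrite // subr0; exact: scaled1.
  rewrite -pt_apex pbaseK pheightK; split; rewrite // subrr; split=> //.
  by exists 0; rewrite ?scaler0.
rewrite -{3}(ptK y); set x := pbase y; set t := pheight y.
move=> [t0 [t1 [c Cc <-]]].
have -> : pt ((1 - t) *: c) t = (1 - t) *: pt c 0 + t *: pt 0 1.
  by rewrite -!ptZ -ptD scaler0 addr0 mulr0 add0r mulr1.
move=> K [/convex_setP cK genK]; apply: cK; rewrite ?subrK//.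
  by apply: genK; left; exists c; rewrite // pt_base.
by apply: genK; right; rewrite pt_apex.
Qed.

End Pyramid.

Section BlockMap.
Context (R : realType) (M : 'M[R]_3).
Let Mb : 'M[R]_(2 + 1) := M.

Lemma mulmx_pt x t : pt x t *m M =
  pt (x *m ulsubmx Mb + t *: dlsubmx Mb) (lform (ursubmx Mb) x + t * drsubmx Mb 0 0).
Proof.
have := mul_row_block x t%:M (ulsubmx Mb) (ursubmx Mb) (dlsubmx Mb) (drsubmx Mb).
rewrite submxK !mul_scalar_mx => E; apply: (etrans E).
congr row_mx; rewrite [LHS]mx11_scalar; congr (_%:M).
by rewrite /lform !mxE.
Qed.

End BlockMap.

Lemma pyramid_sandwich_base (R : realType) (C1 C2 : set 'rV[R]_2) (rho : R)
    (T : {linear 'rV[R]_3 -> 'rV[R]_3}) (u v : 'rV[R]_3) :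
  convex_body C1 -> zero_symmetric C1 -> convex_body C2 -> zero_symmetric C2 ->
  rho < 2 -> 0 <= rho -> bijective T ->
  translate (pyramid C1) u `<=` T @` translate (pyramid C2) v ->
  T @` translate (pyramid C2) v `<=` dilate rho (translate (pyramid C1) u) ->
  sandwich C1 C2 rho.
Proof.
move=> b1 s1 b2 s2 rho2 rho0 bT sub1 sub2.
have [_ cv1 _] := b1; have [_ cv2 _] := b2.
have z1 := body0 b1 s1; have z2 := body0 b2 s2.
have [T' [_ TK KT]] := linear_inverse bT.
pose M := lin1_mx T : 'M[R]_(2 + 1); pose N := lin1_mx T' : 'M[R]_(2 + 1).
have ME y : T y = y *m M by rewrite mul_rV_lin1.
have NE y : T' y = y *m N by rewrite mul_rV_lin1.
have NM : N *m M = 1%:M.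
  by apply/row_matrixP => i; rewrite !rowE mulmxA -NE -ME KT mulmx1.
have MN : M *m N = 1%:M by exact: mulmx1C.
(* [F] is [y] mapped to [T' (y + u) - v], and [G] is [y] mapped to [T (y + v) - rho *: u]. *)
pose wF := T' u - v; pose wG := T v - rho *: u.
have F_map y : pyramid C1 y -> pyramid C2 (y *m N + wF).
  move=> Py; have [_ [Y PY <-] YE] : (T @` translate (pyramid C2) v) (y + u).
    by apply: sub1; exists y.
  have := congr1 T' YE; rewrite TK linearD => E.
  by rewrite /wF addrA -NE -E addrK.
have G_map y : pyramid C2 y ->
    cone_at rho C1 (pbase (y *m M + wG)) (pheight (y *m M + wG)).
  move=> Py; have [_ [Y PY <-] YE] : dilate rho (translate (pyramid C1) u) (T (y + v)).
    by apply: sub2; exists (y + v) => //; exists y.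
  have -> : y *m M + wG = rho *: Y.
    by rewrite /wG addrA -ME -linearD -YE scalerDr addrK.
  rewrite pbaseZ pheightZ; move/(pyramidP cv1 z1): PY => [h hC].
  split; first exact: mulr_ge0.
  have := scaledZ s1 rho hC; rewrite ger0_norm//.
  by congr (scaled _ _ _); ring.
(* Read block by block, the two inverse identities yield the [inv_] hypotheses of the core. *)
move: NM MN; rewrite -[N](@submxK _ 2 1 2 1) -[M](@submxK _ 2 1 2 1).
rewrite !mulmx_block -[1%:M](@submxK _ 2 1 2 1).
move=> /eq_block_mx[e1 e2 e3 e4] /eq_block_mx[e1' e2' e3' e4'].
have ul1 : ulsubmx (1%:M : 'M[R]_(2 + 1)) = 1%:M by rewrite scalar_mx_block block_mxKul.
have ur1 : ursubmx (1%:M : 'M[R]_(2 + 1)) = 0 by rewrite scalar_mx_block block_mxKur.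
have dr1 : drsubmx (1%:M : 'M[R]_(2 + 1)) = 1%:M by rewrite scalar_mx_block block_mxKdr.
apply: (@cone_sandwich_base R C1 C2 b1 s1 b2 s2 (ulsubmx N) (ulsubmx M)
  (ursubmx N) (ursubmx M) (dlsubmx N) (dlsubmx M) (pbase wF) (pbase wG)
  (drsubmx N 0 0) (drsubmx M 0 0) (pheight wF) (pheight wG) rho) => //.
- move=> x t Cx; have /F_map : pyramid C1 (pt x t).
    by apply/(pyramidP cv1 z1); rewrite pbaseK pheightK.
  rewrite mulmx_pt => /(pyramidP cv2 z2).
  by rewrite pbaseD pheightD pbaseK pheightK.
- move=> x t Cx; have /G_map : pyramid C2 (pt x t).
    by apply/(pyramidP cv2 z2); rewrite pbaseK pheightK.
  by rewrite mulmx_pt pbaseD pheightD pbaseK pheightK.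
- by rewrite e1 ul1.
- by rewrite -ur1 -e2 [drsubmx M]mx11_scalar mul_mx_scalar mxE mulr1n.
- have := congr1 (fun X : 'M[R]_1 => X 0 0) e4.
  by rewrite dr1 /= mxE [X in _ + X]mxE big_ord1 [RHS]mxE.
- by rewrite e1' ul1.
- by rewrite -ur1 -e2' [drsubmx N]mx11_scalar mul_mx_scalar mxE mulr1n.
Qed.

(** * Auerbach bases and the bound 2 in the plane *)

Definition vec2 (R : realType) (a b : R) : 'rV[R]_2 :=
  \row_j (if j == 0 then a else b).

Definition det2 (R : realType) (x y : 'rV[R]_2) : R :=
  x 0 0 * y 0 1 - x 0 1 * y 0 0.

Lemma row2P (R : realType) (x y : 'rV[R]_2) :
  x 0 0 = y 0 0 -> x 0 1 = y 0 1 -> x = y.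
Proof.
move=> e0 e1; apply/rowP => i.
have [->//|->//] : i = 0 \/ i = 1.
by case: i => [[|[|]]] // ?; [left|right]; exact: val_inj.
Qed.

(** A pair [a], [b] in [C] of maximal determinant is an Auerbach basis: by Cramer's rule the
    coordinates of a point of [C] are quotients of determinants by the maximal one. *)
Lemma auerbach2 (R : realType) (C : set 'rV[R]_2) :
  convex_body C -> zero_symmetric C ->
  exists2 T : {linear 'rV[R]_2 -> 'rV[R]_2}, bijective T &
    (forall x : 'rV[R]_2, `|x 0 0| + `|x 0 1| <= 1 -> C (T x)) /\
    (forall z, C z -> exists2 x : 'rV[R]_2, `|x 0 0| <= 1 /\ `|x 0 1| <= 1 & T x = z).
Proof.
move=> bC sC; have [cC cv _] := bC; have C0 := body0 bC sC.
have [|||[a b] /=] := @compact_EVT_max _ R (fun z => det2 z.1 z.2) (C `*` C).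
- by exists (0, 0).
- exact: compact_setX.
- apply: continuous_subspaceT => z; rewrite /det2.
  have co1 (k : 'I_2) : (fun w : 'rV[R]_2 * 'rV[R]_2 => w.1 0 k) @ z --> z.1 0 k.
    by apply: (@continuous_comp _ _ _ fst (fun x : 'rV[R]_2 => x 0 k));
      [exact: cvg_fst|exact: coord_continuous].
  have co2 (k : 'I_2) : (fun w : 'rV[R]_2 * 'rV[R]_2 => w.2 0 k) @ z --> z.2 0 k.
    by apply: (@continuous_comp _ _ _ snd (fun x : 'rV[R]_2 => x 0 k));
      [exact: cvg_snd|exact: coord_continuous].
  by apply: cvgB; apply: cvgM.
rewrite inE => -[/= Ca Cb] hmax.
have {}hmax x y : C x -> C y -> det2 x y <= det2 a b.
  by move=> Cx Cy; apply: (hmax (x, y)); rewrite inE.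
set D := det2 a b in hmax *.
have D0 : 0 < D.
  have [s s0 Cs] := body_absorbing bC sC (vec2 1 0).
  have [t t0 Ct] := body_absorbing bC sC (vec2 0 1).
  apply: lt_le_trans (hmax _ _ Cs Ct); rewrite /det2 !mxE /=.
  by rewrite !mulr0 !mulr1 subr0 mulr_gt0.
pose f (x : 'rV[R]_2) := x 0 0 *: a + x 0 1 *: b.
have f_linear : linear f.
  by move=> k x y; rewrite /f; apply/rowP => i; rewrite !mxE; ring.
pose T : {linear 'rV[R]_2 -> 'rV[R]_2} :=
  HB.pack f (GRing.isLinear.Build R _ _ _ f f_linear).
pose g (z : 'rV[R]_2) := vec2 (det2 z b / D) (det2 a z / D).
have gK : cancel g f.
  by move=> z; apply: row2P; rewrite /g /f !mxE /=; move: D0; rewrite /D /det2 => D0;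
    field; rewrite gt_eqF.
have fK : cancel f g.
  by move=> x; apply: row2P; rewrite /g /f !mxE /= /D /det2 !mxE;
    move: D0; rewrite /D /det2 => D0; field; rewrite gt_eqF.
exists T; first by exists g.
split=> [x hx|z Cz].
  have h0 := scaledZ sC (x 0 0) (scaled1 Ca).
  have h1 := scaledZ sC (x 0 1) (scaled1 Cb).
  have := scaled_le1 cv C0 (scaledD cv C0 h0 h1); apply.
  by rewrite !mulr1.
exists (g z); last exact: gK.
have bnd (w : R) : w <= D -> - w <= D -> `|w / D| <= 1.
  move=> w1 w2; rewrite normrM normfV (gtr0_norm D0) ler_pdivrMr// mul1r ler_norml.
  by rewrite w1 lerNl w2.
split; rewrite !mxE /=; apply: bnd; rewrite ?hmax//.
  have -> : - det2 z b = det2 (- z) b by rewrite /det2 !mxE; ring.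
  by rewrite hmax//; exact: body_opp.
have -> : - det2 a z = det2 a (- z) by rewrite /det2 !mxE; ring.
by rewrite hmax//; exact: body_opp.
Qed.

(** Each body lies, in its Auerbach coordinates, between the cross-polytope and the square. In the
    plane half of [h] carries the square into the cross-polytope, and [h] is its own inverse up to
    the factor 2. *)
Lemma sandwich2 (R : realType) (C1 C2 : set 'rV[R]_2) :
  convex_body C1 -> zero_symmetric C1 -> convex_body C2 -> zero_symmetric C2 ->
  sandwich C1 C2 2.
Proof.
move=> b1 s1 b2 s2.
have [T1 bT1 [in1 out1]] := auerbach2 b1 s1.
have [T2 bT2 [in2 out2]] := auerbach2 b2 s2.
have [T2' [bT2' TK KT]] := linear_inverse bT2.
pose h (x : 'rV[R]_2) := vec2 (x 0 0 + x 0 1) (x 0 0 - x 0 1).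
have h_linear : linear h.
  by move=> k x y; apply: row2P; rewrite !mxE /=; ring.
pose H : {linear 'rV[R]_2 -> 'rV[R]_2} :=
  HB.pack h (GRing.isLinear.Build R _ _ _ h h_linear).
have hh x : h (h x) = 2 *: x by apply: row2P; rewrite !mxE /=; ring.
have bH : bijective H.
  exists (fun x => 2^-1 *: h x) => x; rewrite /H/=.
    by rewrite hh scalerA mulVf// scale1r.
  rewrite -[h (_ *: _)]/(H (2^-1 *: h x)) linearZ/= hh scalerA mulVf//.
  by rewrite scale1r.
have half_norm (x : 'rV[R]_2) : `|x 0 0| <= 1 -> `|x 0 1| <= 1 ->
    `|(2^-1 *: h x) 0 0| + `|(2^-1 *: h x) 0 1| <= 1.
  rewrite !mxE /= !ler_norml => /andP[? ?] /andP[? ?].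
  by case: (ger0P (2^-1 * (x 0 0 + x 0 1))) => ?;
     case: (ger0P (2^-1 * (x 0 0 - x 0 1))) => ?; lra.
exists (T1 \o H \o T2'); split.
- exact: bij_comp (bij_comp bT1 bH) bT2'.
- move=> _ /out1[x [x0 x1] <-]; exists (T2 (2^-1 *: h x)).
    exact/in2/half_norm.
  by rewrite /= TK -[h _]/(H _) linearZ/= hh scalerA mulVf// scale1r.
- move=> _ [_ /out2[x [x0 x1] <-] <-]; exists (T1 (2^-1 *: h x)).
    exact/in1/half_norm.
  by rewrite /= TK linearZ/= scalerA divff// scale1r.
Qed.

Lemma dilate1 (R : realType) (n : nat) (K : set 'rV[R]_n) : dilate 1 K = K.
Proof.
apply/seteqP; split=> [_ [x Kx <-]|x Kx]; first by rewrite scale1r.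
by exists x; rewrite ?scale1r.
Qed.

(** * Removing translations between symmetric bodies *)

Section Symmetric.
Context (R : realType) (n : nat) (C : set 'rV[R]_n).
Hypotheses (bodyC : convex_body C) (symC : zero_symmetric C).

Lemma half_diff x y : C x -> C y -> C (2^-1 *: (x - y)).
Proof.
move=> Cx Cy; have [_ cC _] := bodyC.
rewrite scalerBr -scalerN; apply: ((convex_setP C).1 cC) => //; try lra.
exact: (body_opp symC).
Qed.

Lemma body_dilate_ge1 (rho : R) :
  (0 < n)%N -> 0 <= rho -> C `<=` dilate rho C -> 1 <= rho.
Proof.
move=> n0 rho0 sub; rewrite leNgt; apply/negP => rho1.
have x0 : (const_mx 1 : 'rV[R]_n) != 0.
  apply/eqP => /rowP /(_ (Ordinal n0)); rewrite !mxE => /eqP.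
  by rewrite oner_eq0.
by apply: (body_not_shrinking bodyC symC x0 rho1) => t /sub.
Qed.

End Symmetric.

Section Centering.
Context (R : realType) (n : nat) (C1 C2 : set 'rV[R]_n).
Hypotheses (body1 : convex_body C1) (sym1 : zero_symmetric C1).
Hypotheses (body2 : convex_body C2) (sym2 : zero_symmetric C2).
Context (T : {linear 'rV[R]_n -> 'rV[R]_n}) (u v : 'rV[R]_n) (rho : R).

(** Half the difference of preimages of [x + u] and [- x + u] no longer depends on [u] and [v]. *)
Lemma centered_inner :
  translate C1 u `<=` T @` translate C2 v -> C1 `<=` T @` C2.
Proof.
move=> sub x Cx.
have [_ [y1 Cy1 <-] e1] : (T @` translate C2 v) (x + u) by apply: sub; exists x.
have [_ [y2 Cy2 <-] e2] : (T @` translate C2 v) (- x + u).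
  by apply: sub; exists (- x) => //; exact: (body_opp sym1).
exists (2^-1 *: (y1 - y2)); first exact: half_diff.
have -> : y1 - y2 = (y1 + v) - (y2 + v) by rewrite opprD addrACA subrr addr0.
by rewrite linearZ linearB e1 e2; apply/rowP => i; rewrite !mxE; field.
Qed.

Lemma centered_outer :
  T @` translate C2 v `<=` dilate rho (translate C1 u) ->
  T @` C2 `<=` dilate rho C1.
Proof.
move=> sub _ [z Cz <-].
have [_ [x1 Cx1 <-] e1] : dilate rho (translate C1 u) (T (z + v)).
  by apply: sub; exists (z + v) => //; exists z.
have [_ [x2 Cx2 <-] e2] : dilate rho (translate C1 u) (T (- z + v)).
  apply: sub; exists (- z + v) => //; exists (- z) => //.
  exact: (body_opp sym2).
exists (2^-1 *: (x1 - x2)); first exact: half_diff.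
have -> : T z = 2^-1 *: (T (z + v) - T (- z + v)).
  by rewrite -linearB -linearZ; congr (T _); apply/rowP => i; rewrite !mxE; field.
by rewrite -e1 -e2; apply/rowP => i; rewrite !mxE; ring.
Qed.

End Centering.


(** * Extending planar maps to pyramids *)

Lemma extend_linear (R : realType) (T : {linear 'rV[R]_2 -> 'rV[R]_2}) :
  bijective T ->
  exists2 T3 : {linear 'rV[R]_3 -> 'rV[R]_3}, bijective T3 &
    forall x t, T3 (pt x t) = pt (T x) t.
Proof.
case=> g gK Kg.
pose h (y : 'rV[R]_3) := pt (T (pbase y)) (pheight y).
have h_linear : linear h.
  move=> k y z; rewrite /h pbaseD pbaseZ pheightD pheightZ linearD linearZ.
  by rewrite ptD ptZ.
pose T3 : {linear 'rV[R]_3 -> 'rV[R]_3} :=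
  HB.pack h (GRing.isLinear.Build R _ _ _ h h_linear).
exists T3; last by move=> x t; rewrite /T3/= /h pbaseK pheightK.
exists (fun y => pt (g (pbase y)) (pheight y)) => y; rewrite /T3/= /h.
  by rewrite pbaseK pheightK gK ptK.
by rewrite pbaseK pheightK Kg ptK.
Qed.

Section Extension.
Context (R : realType) (C1 C2 : set 'rV[R]_2).
Hypotheses (conv1 : convex_set (M := 'rV[R]_2) C1) (zero1 : C1 0).
Hypotheses (conv2 : convex_set (M := 'rV[R]_2) C2) (zero2 : C2 0).
Context (T : {linear 'rV[R]_2 -> 'rV[R]_2}) (T3 : {linear 'rV[R]_3 -> 'rV[R]_3}).
Hypothesis T3E : forall x t, T3 (pt x t) = pt (T x) t.

Lemma pyramid_inner : C1 `<=` T @` C2 -> pyramid C1 `<=` T3 @` pyramid C2.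
Proof.
move=> sub y /(pyramidP conv1 zero1) [t0 [t1 [c Cc cE]]].
have [c' Cc' c'E] := sub _ Cc.
exists (pt ((1 - pheight y) *: c') (pheight y)).
  apply/(pyramidP conv2 zero2); rewrite pbaseK pheightK; split=> //; split=> //.
  by exists c'.
by rewrite T3E linearZ/= c'E cE ptK.
Qed.

Lemma pyramid_outer (rho : R) : 1 <= rho -> T @` C2 `<=` dilate rho C1 ->
  T3 @` pyramid C2 `<=` dilate rho (pyramid C1).
Proof.
move=> rho1 sub _ [y /(pyramidP conv2 zero2) [t0 [t1 [c Cc cE]]] <-].
have [c' Cc' c'E] : dilate rho C1 (T c) by apply: sub; exists c.
set t := pheight y in t0 t1 cE *.
have rho0 : 0 < rho by lra.
have rhon0 : rho != 0 by rewrite gt_eqF.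
(* The height is divided by [rho] as well; the point stays in the pyramid since
   [1 - t <= 1 - t / rho] for [1 <= rho]. *)
exists (pt ((1 - t) *: c') (t / rho)).
  apply/(pyramidP conv1 zero1); rewrite pbaseK pheightK; split.
    by rewrite divr_ge0// ltW.
  apply: (@scaled_le _ _ _ conv1 zero1 (1 - t)); first by split=> //; exists c'.
  by rewrite lerD2l lerN2 ler_pdivrMr// ler_peMr.
rewrite -ptZ mulrC divfK// scalerA mulrC -scalerA c'E -linearZ cE -T3E.
by rewrite ptK.
Qed.

End Extension.

(** * The pyramid is a convex body *)

Lemma pt_lshift (R : realType) (x : 'rV[R]_2) t i (j : 'I_2) :
  pt x t i (lshift 1 j : 'I_(2 + 1)) = x i j.
Proof. exact: row_mxEl. Qed.

Lemma pt_rshift (R : realType) (x : 'rV[R]_2) t : pt x t 0 (rshift 2 0 : 'I_(2 + 1)) = t.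
Proof. by rewrite [LHS]row_mxEr mxE. Qed.

Lemma pt_continuous (R : realType) :
  continuous (fun w : 'rV[R]_2 * R => pt w.1 w.2).
Proof.
move=> [x t]; apply/cvg_ballP => e e0; near=> w.
split=> // i j; rewrite /pt /= !mxE.
case: splitP => k _; rewrite ?mxE.
  suff [_] : ball x e w.1 by [].
  by near: w; apply: cvg_fst; exact: nbhsx_ballx.
rewrite !ord1/= !mulr1n.
by near: w; apply: cvg_snd; exact: nbhsx_ballx.
Unshelve. all: by end_near. Qed.

Lemma pyramid_body (R : realType) (C : set 'rV[R]_2) :
  convex_body C -> zero_symmetric C -> convex_body (pyramid C).
Proof.
move=> bC sC; have [cC cv _] := bC; have C0 := body0 bC sC; split.
- have -> : pyramid C =
      (fun w : 'rV[R]_2 * R => pt ((1 - w.2) *: w.1) w.2) @` (C `*` `[0, 1]%classic).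
    apply/seteqP; split=> [y /(pyramidP cv C0) [t0 [t1 [c Cc cE]]]|].
      exists (c, pheight y); last by rewrite /= cE ptK.
      by split=> //=; rewrite in_itv/= t0/=; lra.
    move=> _ [[c t] [/= Cc t01] <-]; move: t01; rewrite in_itv/= => /andP[t0 t1].
    apply/(pyramidP cv C0); rewrite pbaseK pheightK; split=> //.
    by split; [lra|exists c].
  apply: continuous_compact; last first.
    by apply: compact_setX => //; exact: segment_compact.
  apply: continuous_subspaceT => w.
  apply: (@continuous_comp _ _ _ (fun w : 'rV[R]_2 * R => ((1 - w.2) *: w.1, w.2))
    (fun w => pt w.1 w.2)); last first.
    exact: pt_continuous.
  apply: (@cvg_pair _ _ _ _ (nbhs ((1 - w.2) *: w.1)) (nbhs w.2)); last exact: cvg_snd.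
  apply: cvgZ; last exact: cvg_fst.
  by apply: cvgB; [exact: cvg_cst|exact: cvg_snd].
- apply/convex_setP => x y s t s0 t0 st Cx Cy K [cK sK].
  exact: ((convex_setP K).1 cK _ _ _ _ s0 t0 st (Cx _ (conj cK sK)) (Cy _ (conj cK sK))).
- have [r r0 rC] := body_ball0 bC sC.
  (* Within [4^-1] of this point heights stay in []0, 1/2[], so a base component of norm below
     [r / 2] is also below [(1 - pheight y) * r]. *)
  exists (pt 0 4^-1); apply/nbhs_ballP.
  exists (Num.min (r / 2) 4^-1) => /=; first by rewrite lt_min; apply/andP; split; lra.
  move=> y; rewrite -{1}[y]ptK => -[e0 hy].
  have hb : `|pbase y| < r / 2.
    rewrite -[pbase y]opprK normrN -sub0r.
    suff : ball 0 (r / 2) (pbase y) by rewrite -ball_normE.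
    split; first by rewrite divr_gt0.
    move=> i j; have := hy i (lshift 1 j : 'I_(2 + 1)); rewrite !pt_lshift.
    by apply: le_ball; rewrite ge_min lexx.
  have ht : `|pheight y - 4^-1| < 4^-1.
    have := hy 0 (rshift 2 0 : 'I_(2 + 1)); rewrite !pt_rshift.
    by rewrite -ball_normE /= distrC lt_min => /andP[].
  move: ht; rewrite ltr_norml => /andP[t1 t2].
  apply/(pyramidP cv C0); split; first lra.
  have l0 : 0 < 1 - pheight y by lra.
  split; first exact: ltW.
  exists ((1 - pheight y)^-1 *: pbase y); last by rewrite scalerA divff ?scale1r// gt_eqF.
  apply: rC; rewrite normrZ normfV gtr0_norm// mulrC ltr_pdivrMr//.
  by apply: lt_le_trans hb _; nra.
Qed.

(** * Passage to affine classes and the isometry *)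

Lemma affine_class_eq (R : realType) n (K L : set 'rV[R]_n) :
  affine_class K L -> affine_class K = affine_class L.
Proof.
suff sub (K1 K2 : set 'rV[R]_n) :
    affine_class K1 K2 -> affine_class K2 `<=` affine_class K1.
  move=> KL; apply/seteqP; split; apply: sub => //.
  exact: affine_class_sym.
move=> [A [a [bA ->]]] _ [B [b [bB ->]]].
exists (B \o A), (B a + b); split; first exact: bij_comp.
by rewrite image_translate translateD image_comp.
Qed.

Lemma symmetric_affine (R : realType) (n : nat) (C D : set 'rV[R]_n) :
  convex_body C -> zero_symmetric C -> convex_body D -> zero_symmetric D ->
  affine_class C D ->
  exists2 T : {linear 'rV[R]_n -> 'rV[R]_n}, bijective T & D = T @` C.
Proof.
move=> bC sC bD sD [T [u [bT DE]]]; exists T => //.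
have [g _ Kg] := bT.
have {}DE : D = T @` translate C (g u) by rewrite image_translate Kg.
apply/seteqP; split.
  by apply: (centered_inner sD bC sC (u := 0) (v := g u)); rewrite translate0 -DE.
rewrite -[D]dilate1.
by apply: (centered_outer bD sD sC (u := 0) (v := g u)); rewrite translate0 dilate1 -DE.
Qed.

Lemma BM_dist_pyramid (R : realType) (C1 C2 : set 'rV[R]_2) :
  convex_body C1 -> zero_symmetric C1 -> convex_body C2 -> zero_symmetric C2 ->
  BM_dist (pyramid C1) (pyramid C2) = BM_dist C1 C2.
Proof.
move=> b1 s1 b2 s2.
have [_ cv1 _] := b1; have [_ cv2 _] := b2.
have z1 := body0 b1 s1; have z2 := body0 b2 s2.
rewrite /BM_dist; set E3 := [set _ | _]; set E2 := [set _ | _].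
(* Used twice: it makes both sets nonempty, and it settles the case [2 <= rho] of the second
   inequality. *)
have E20 : E2 2.
  have [T [bT sub1 sub2]] := sandwich2 b1 s1 b2 s2.
  by split=> //; exists T, 0, 0; rewrite !translate0.
have E23 : E2 `<=` E3.
  move=> rho [rho0 [T [u [v [bT sub1 sub2]]]]]; split=> //.
  have {}sub1 := centered_inner s1 b2 s2 sub1.
  have {}sub2 := centered_outer b1 s1 s2 sub2.
  have rho1 : 1 <= rho.
    apply: (@body_dilate_ge1 _ _ _ b1 s1) => //.
    exact: subset_trans sub1 sub2.
  have [T3 bT3 T3E] := extend_linear bT.
  exists T3, 0, 0; rewrite !translate0; split=> //.
    exact: (pyramid_inner cv1 z1 cv2 z2 T3E sub1).
  exact: (pyramid_outer cv1 z1 cv2 z2 T3E rho1 sub2).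
have lb2 : has_lbound E2 by exists 0 => rho [].
have lb3 : has_lbound E3 by exists 0 => rho [].
apply/eqP; rewrite eq_le; apply/andP; split.
  apply: lb_le_inf; first by exists 2.
  by move=> rho /E23 E3rho; exact: ge_inf.
apply: lb_le_inf; first by exists 2; exact: E23.
move=> rho [rho0 [T [u [v [bT sub1 sub2]]]]].
have [rho2|rho2] := ltP rho 2; last by apply: le_trans rho2; exact: ge_inf.
apply: ge_inf => //; split=> //.
have [S [bS sub1' sub2']] :=
  pyramid_sandwich_base b1 s1 b2 s2 rho2 rho0 bT sub1 sub2.
by exists S, 0, 0; rewrite !translate0.
Qed.

(** Makes the map on classes independent of the symmetric representative: a linear map carrying [C]
    onto [D] extends by the identity on the axis. *)
Lemma affine_class_pyramid (R : realType) (C D : set 'rV[R]_2) :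
  convex_body C -> zero_symmetric C -> convex_body D -> zero_symmetric D ->
  affine_class C D -> affine_class (pyramid C) = affine_class (pyramid D).
Proof.
move=> bC sC bD sD /(symmetric_affine bC sC bD sD)[T bT DE].
have [T3 bT3 T3E] := extend_linear bT.
have [_ cvC _] := bC; have [_ cvD _] := bD.
have zC := body0 bC sC; have zD := body0 bD sD.
apply: affine_class_eq; exists T3, 0; split=> //; rewrite translate0.
apply/seteqP; split.
  by apply: (pyramid_inner cvD zD cvC zC T3E); rewrite -DE.
rewrite -[pyramid D]dilate1.
by apply: (pyramid_outer cvD zD cvC zC T3E) => //; rewrite dilate1 -DE.
Qed.

Theorem corollary1p6 (R : realType) :
  exists phi : BMs R 2 -> BM R 3,
    (forall (X : BMs R 2) (C : set 'rV[R]_2),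
       convex_body C -> zero_symmetric C -> val X C ->
       val (phi X) = affine_class (pyramid C)) /\
    (forall X1 X2 : BMs R 2,
       BM_class_dist (val (phi X1)) (val (phi X2)) =
       BM_class_dist (val X1) (val X2)).
Proof.
have rep (X : BMs R 2) : exists C : set 'rV[R]_2,
    [/\ convex_body C, zero_symmetric C & val X = affine_class C].
  by have := set_valP X; rewrite /BMs/= => -[C [bC sC] <-]; exists C.
have img (X : BMs R 2) : exists Y : BM R 3, exists C : set 'rV[R]_2,
    [/\ convex_body C, zero_symmetric C, val X = affine_class C
      & val Y = affine_class (pyramid C)].
  have [C [bC sC XE]] := rep X.
  have mem : affine_class (pyramid C) \in BM R 3.
    by rewrite inE; exists (pyramid C) => //; exact: pyramid_body.
  by exists (SigSub mem), C.
have [phi phiP] := choice img.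
exists phi; split=> [X C bC sC XC|X1 X2].
  have [D [bD sD XE ->]] := phiP X.
  by apply: affine_class_pyramid => //; rewrite -XE.
have [C1 [b1 s1 -> ->]] := phiP X1.
have [C2 [b2 s2 -> ->]] := phiP X2.
by rewrite !BM_class_distE BM_dist_pyramid.
Qed.
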